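(* Consider the perturbed spreading algorithm described in the context, with $|\epsilon_{ij}(t)|\le\epsilon<e_{\min}$, and with $f$ also monotonically increasing (in the non-strict sense) in its second argument and Lipschitz with constants $L_1$ (second argument) and $L_2$ (first argument). Suppose the dead zone parameter $D$ satisfies $$D\ \ge\ \big(W(L_2,\mathcal{D}(\mathcal{G}^-)-1)+W(L_2,\mathcal{D}(\mathcal{G})-1)\big)L_1\epsilon .$$ Let $$T^-=\Big\lceil\frac{X_{\max}-\hat{x}_{\min}(t_0)}{\min\{\delta,\sigma\}}\Big\rceil,\qquad T_l^-=\max\Big\{0,\Big\lceil\frac{M-X_{l\min}}{\delta}\Big\rceil\Big\}+2 .$$ Then for all $i\in V$ and all $t\ge t_0+T^-+\sum_{l=0}^{\mathcal{D}(\mathcal{G})-1}T_l^-$, $$|\hat{x}_i(t)-x_i|\ \le\ \epsilon L_1\max\big\{W(L_2,\mathcal{D}(\mathcal{G})-1),\,W(L_2,\mathcal{D}(\mathcal{G}^-)-1)\big\}.$$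
   Context: Setting. $\mathcal{G}=(V,E)$ is a finite connected undirected graph, $V=\{1,\dots,N\}$; $\mathcal{N}(i)$ is the set of neighbors of $i$. Each pair of neighbors has a nominal edge value $e_{ik}=e_{ki}$ with $0<e_{\min}\le e_{ik}<\infty$. Each node has a maximum value $s_i\ge0$, finite or infinite, and $\mathcal{S}^*=\{i\in V:s_i<\infty\}$ is nonempty. Perturbed edge values: $e_{ij}(t)=e_{ij}+\epsilon_{ij}(t)$ with $|\epsilon_{ij}(t)|\le\epsilon<e_{\min}$ (possibly $\epsilon_{ij}(t)\ne\epsilon_{ji}(t)$). The function $f(a,b)$ (first argument a state value, second an edge value) is finite for finite $a,b$; it is progressive: for some $\sigma>0$, $f(a,b)>a+\sigma$; monotonic: $f(a_1,b)\ge f(a_2,b)$ if $a_1\ge a_2$, and $f(a,b_1)\ge f(a,b_2)$ if $b_1\ge b_2$; and for some $L_1,L_2>0$: $|f(a,b_1)-f(a,b_2)|\le L_1|b_1-b_2|$ and $|f(a_1,b)-f(a_2,b)|\le L_2|a_1-a_2|$. Algorithm. Time $t$ is an integer, $t\ge t_0$; the initial estimates $\hat{x}_i(t_0)$ are non-negative real numbers. Constants: finite $M\ge0$, $\delta>0$, $D\ge0$, and a function $g$, finite for finite arguments, with $g(y)\ge y+\delta$. For $t\ge t_0$, $\tilde{x}_i(t+1)=\min\{\min_{k\in\mathcal{N}(i)}f(\hat{x}_k(t),e_{ik}(t)),s_i\}$, and $\hat{x}_i(t+1)=\tilde{x}_i(t+1)$ if $\hat{x}_i(t)\ge M$ or $|\hat{x}_i(t)-\tilde{x}_i(t+1)|\le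 D$; otherwise $\hat{x}_i(t+1)=g(\hat{x}_i(t))$. Stationary points. $x=(x_i)$ is the unique solution of $x_i=\min\{\min_{k\in\mathcal{N}(i)}f(x_k,e_{ik}),s_i\}$ for all $i\in V$ (it exists and has finite entries). The shrunken graph $\mathcal{G}^-$ is $\mathcal{G}$ with each $e_{ij}$ replaced by $e_{ij}^-=e_{ij}-\epsilon$; $X=(X_i)$ is its stationary point, i.e. the unique solution of $X_i=\min\{\min_{k\in\mathcal{N}(i)}f(X_k,e_{ik}^-),s_i\}$ for all $i\in V$. Effective diameter and $\mathcal{F}_l$. For $\mathcal{G}$ with stationary point $x$, put $\mathcal{S}_\infty=\{i:x_i=s_i\}$. If $x_i=s_i$, then $i$ is its own true constraining node. Any neighbor $k\in\mathcal{N}(i)$ that minimizes $f(x_k,e_{ik})$ over $\mathcal{N}(i)$ and satisfies $f(x_k,e_{ik})=x_i$ is also a true constraining node of $i$ (when $x_i<s_i$ these are all the minimizing $k$). Thus a node of $\mathcal{S}_\infty$ can have, besides itself, a neighbor as true constraining node. A shortest path from $i$ is a path starting at $i$ and ending at a node of $\mathcal{S}_\infty$, in which each node after the first is a true constraining node of its predecessor (the one-node path is allowed for $i\in\mathcal{S}_\infty$). $\mathcal{F}_l$ is the set of nodes whose longest (in number of nodes) shortest path has $l+1$ nodes, and the effective diameter $\mathcal{D}(\mathcal{G})$ is the number of nodes in the longest shortest path among all $i\in V$. In general $\mathcal{F}_0\subset\mathcal{S}_\infty$ but not conversely: with $f(a,b)=a+b$, all edge values 1, nodes 2 and 3 adjacent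 to node 1, $s_1=0$, $s_2=1$, $s_3=\infty$, one has $x_1=0$, $x_2=x_3=1$, and node 2 is in $\mathcal{S}_\infty$ but lies in $\mathcal{F}_1$. The sets $\mathcal{F}_0,\dots,\mathcal{F}_{\mathcal{D}(\mathcal{G})-1}$ are nonempty and partition $V$. $\mathcal{D}(\mathcal{G}^-)$ is the effective diameter of $\mathcal{G}^-$, defined the same way with $X$ and $e_{ik}^-$ in place of $x$ and $e_{ik}$. Other quantities. $W(L,n)=\sum_{i=0}^{n-1}L^i$, equal to zero if the lower limit exceeds the upper. $X_{\max}=\max_{k\in V} X_k$; $X_{l\min}=\min_{j\in\mathcal{F}_l}X_j$. Let $\mathcal{U}(t_0)=V\setminus\{i\in\mathcal{S}^*:\hat{x}_i(t_0)=s_i\}$; if $\mathcal{U}(t_0)\ne\emptyset$, $\hat{x}_{\min}(t_0)=\min_{j\in\mathcal{U}(t_0)}\hat{x}_j(t_0)$.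
   Formalization: T^- is replaced by max{0, T^-} (and set to 0 when U(t_0) is empty, where it is undefined); with a negative T^- the claim as written can fail, e.g. at t = t_0 when all initial estimates far exceed X_max. *)

(* Defs.v *)
From mathcomp Require Import all_boot all_order all_algebra.
From mathcomp Require Import constructive_ereal reals.

Set Implicit Arguments.
Unset Strict Implicit.
Unset Printing Implicit Defensive.

Import Order.TTheory GRing.Theory Num.Theory.

Local Open Scope ring_scope.

Section Spreading.
Context {R : realType} {V : finType}.

(* A graph on V is a relation adj, with adj i k meaning that k is a neighbor
   of i.  The edge values e i k are only meaningful when adj i k holds.
   The maximum values s i lie in \bar R since they may be infinite. *)
Implicit Types (adj : rel V) (f : R -> R -> R) (e : V -> V -> R)
  (s : V -> \bar R) (x y : V -> R) (A : {set V}).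

(* min { min_{k in N(i)} f(y_k, e_ik), s_i }; the minimum over an empty
   neighborhood (one-node graph) is +oo. *)
Definition update adj f e s y (i : V) : \bar R :=
  mine (\big[mine/+oo%E]_(k | adj i k) (f (y k) (e i k))%:E) (s i).

(* State values are non-negative reals. *)
Definition stationary adj f e s x : Prop :=
  forall i, 0 <= x i /\ (x i)%:E = update adj f e s x i.

Definition Sinfty s x : {set V} := [set i | (x i)%:E == s i].

Definition true_constraining adj f e s x : rel V := fun i k =>
  ((k == i) && (i \in Sinfty s x))
  || [&& adj i k,
         [forall j, adj i j ==> (f (x k) (e i k) <= f (x j) (e i j))]
       & f (x k) (e i k) == x i].

(* i :: p is a shortest path from i; as a path, it has no repeated node
   (nodes of Sinfty are their own true constraining nodes). *)
Definition shortest_path adj f e s x (i : V) (p : seq V) : bool :=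
  [&& path (true_constraining adj f e s x) i p,
      uniq (i :: p)
    & last i p \in Sinfty s x].

(* Number of nodes of the longest shortest path from i; a duplicate-free
   i :: p has size p < #|V|, so the range of n covers all shortest paths. *)
Definition longest adj f e s x (i : V) : nat :=
  \max_(n < #|V|)
    \max_(p : n.-tuple V | shortest_path adj f e s x i p) size (i :: p).

Definition Fset adj f e s x (l : nat) : {set V} :=
  [set i | longest adj f e s x i == l.+1].

Definition eff_diam adj f e s x : nat := \max_(i : V) longest adj f e s x i.

Definition W (L : R) (n : nat) : R := \sum_(i < n) L ^+ i.

(* Minimum and maximum of y over a nonempty A (both are 0 if A is empty). *)
Definition minS A y : R := fine (\big[mine/+oo%E]_(j in A) (y j)%:E).
Definition maxS A y : R := fine (\big[maxe/-oo%E]_(j in A) (y j)%:E).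

Definition Sstar s : {set V} := [set i | (s i < +oo)%E].

(* Nodes not initially at their (finite) maximum value; y is the vector of
   initial estimates. *)
Definition Uset s y : {set V} := ~: [set i in Sstar s | (y i)%:E == s i].

(* A duration: the quotient is clamped at 0 when all initial estimates in
   Uset already exceed max X, and the duration is 0 when Uset is empty. *)
Definition Tminus s (X y : V -> R) (delta sigma : R) : int :=
  if Uset s y == set0 then 0
  else Num.max 0
    (Num.ceil ((maxS [set: V] X - minS (Uset s y) y) / Num.min delta sigma)).

Definition Tlminus A (X : V -> R) (M delta : R) : int :=
  Num.max 0 (Num.ceil ((M - minS A X) / delta)) + 2.

End Spreading.

(* Main.v *)
(* Lower bound: by induction, xhat i stays above min(X i, c) with c growing by
   min(delta, sigma) per step, so xhat >= X from t0 + Tminus on; and X is within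
   W(DGm - 1) L1 eps of x, because along a shortest path of the shrunken graph
   each edge multiplies the gap by at most L2 and adds at most L1 eps.
   Upper bound: by induction on the length l + 1 of the longest shortest path
   from i, once the true constraining neighbors of i satisfy their bound, the
   candidate xtilde i is at most x i + W(l) L1 eps and at least X i.  The size of
   D then locks xhat i onto xtilde i as soon as xhat i is in this window, and
   this happens at the latest when growth in steps of delta brings it to M. *)
Require Import Defs.
From mathcomp Require Import all_boot all_order all_algebra.
From mathcomp Require Import constructive_ereal reals.
From mathcomp Require Import lra.

Import Order.TTheory GRing.Theory Num.Theory.

Local Open Scope ring_scope.

(** * Extrema over finite sets of nodes *)

Section Extrema.
Context {R : realType} {V : finType}.

Lemma le_maxS (y : V -> R) (i : V) : y i <= maxS [set: V] y.
Proof.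
(* The node [i] makes the index set nonempty, so the maximum is attained at a real value and [fine]
   loses nothing. *)
rewrite /maxS; have [|j _ ej] := @eq_bigmax _ _ _ -oo%E i
  (mem [set: V]) (fun j => (y j)%:E) (in_setT i); first by move=> *; exact: leNye.
have := @le_bigmax_cond _ _ _ -oo%E i (mem [set: V]) (fun j => (y j)%:E) (in_setT i).
by rewrite ej /= lee_fin.
Qed.

Lemma minS_attained (A : {set V}) (y : V -> R) (i : V) : i \in A ->
  exists2 j, j \in A & minS A y = y j.
Proof.
move=> iA; have [|j jA ej] := @eq_bigmin _ _ _ +oo%E i (mem A)
  (fun j => (y j)%:E) iA; first by move=> *; exact: leey.
by exists j; rewrite // /minS ej.
Qed.

Lemma minS_le (A : {set V}) (y : V -> R) (i : V) : i \in A -> minS A y <= y i.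
Proof.
move=> iA; have [|j jA ej] := @eq_bigmin _ _ _ +oo%E i (mem A)
  (fun j => (y j)%:E) iA; first by move=> *; exact: leey.
have := @bigmin_le_cond _ _ _ +oo%E i (mem A) (fun j => (y j)%:E) iA.
by rewrite /minS ej /= lee_fin.
Qed.

End Extrema.

(** * Shortest paths and the rank [longest] *)

Section ShortestPaths.
Context {R : realType} {V : finType} (adj : rel V) (f : R -> R -> R).
Context (e : V -> V -> R) (s : V -> \bar R) (x : V -> R).

Lemma update_le_max (i : V) : (update adj f e s x i <= s i)%E.
Proof. by rewrite /update ge_min lexx orbT. Qed.

Lemma update_le_nbr (i k : V) : adj i k ->
  (update adj f e s x i <= (f (x k) (e i k))%:E)%E.
Proof.
by move=> ik; rewrite /update ge_min (bigmin_le_cond _ (fun k => (f (x k) (e i k))%:E) ik).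
Qed.

Lemma le_update (c : \bar R) (i : V) : (c <= s i)%E ->
  (forall k, adj i k -> (c <= (f (x k) (e i k))%:E)%E) ->
  (c <= update adj f e s x i)%E.
Proof. by move=> cs cf; rewrite /update le_min cs andbT le_bigmin // leey. Qed.

Notation tc := (true_constraining adj f e s x).
Notation sp := (shortest_path adj f e s x).
Notation len := (longest adj f e s x).

Lemma longest_ge (i : V) (p : seq V) : sp i p -> (size (i :: p) <= len i)%N.
Proof.
move=> ip; have /and3P[_ up _] := ip.
(* Absence of repetitions puts [size p] in the index range of the outer maximum. *)
have ltp : (size p < #|V|)%N by have := max_card (mem (i :: p)); rewrite (card_uniqP up).
apply: (@leq_trans _ _ _ _ (leq_bigmax (Ordinal ltp))) => /=.
exact: (@leq_bigmax_cond _ _ (fun q : (size p).-tuple V => size (i :: q)) (in_tuple p)).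
Qed.

Lemma longest_le_card (i : V) : (len i <= #|V|)%N.
Proof.
apply/bigmax_leqP => n _; apply/bigmax_leqP => p _.
by rewrite /= size_tuple.
Qed.

(** An iterated maximum of naturals is either the default 0 or one of its terms; positivity excludes
    the default. *)
Lemma longest_attained (i : V) : (0 < len i)%N ->
  exists2 p, sp i p & size (i :: p) = len i.
Proof.
suff : len i = 0%N \/ exists2 p, sp i p & size (i :: p) = len i.
  by case=> [->|].
rewrite /longest.
apply: (big_ind (fun m => m = 0%N \/ exists2 p, sp i p & size (i :: p) = m)).
- by left.
- by move=> a b Ka Kb; case: (leqP a b).
move=> n _; apply: (big_ind (fun m => m = 0%N \/ exists2 p, sp i p & size (i :: p) = m)).
- by left.
- by move=> a b Ka Kb; case: (leqP a b).
by move=> p ip; right; exists p.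
Qed.

Lemma longest_le_eff_diam (i : V) : ((len i).-1 <= (eff_diam adj f e s x).-1)%N.
Proof.
rewrite -!subn1; apply: leq_sub2r.
exact: (leq_bigmax (F := fun i => len i)).
Qed.

Lemma eff_diam_le_card (i : V) : ((eff_diam adj f e s x).-1 < #|V|)%N.
Proof.
have V0 : (0 < #|V|)%N by apply/card_gt0P; exists i.
have : (eff_diam adj f e s x <= #|V|)%N.
  by apply/bigmax_leqP => j _; exact: longest_le_card.
by case: (eff_diam _ _ _ _ _).
Qed.

Hypothesis x_stat : stationary adj f e s x.
Hypothesis f_gt : forall i k, adj i k -> x k < f (x k) (e i k).

Lemma Sinfty_or_nbr (i : V) : i \in Sinfty s x \/
  exists k, [/\ adj i k, f (x k) (e i k) = x i & tc i k].
Proof.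
have [_] := x_stat i; rewrite /update.
case: leP => [_ ei|_ ei]; last by left; rewrite inE ei.
(* An empty neighborhood would give the minimum [+oo], but [x i] is real. *)
case: (pickP (adj i)) => [j ij|no]; last first.
  by move: ei; rewrite big_pred0.
have [k ik ek] : {k | k \in adj i &
  (\big[mine/+oo%E]_(k | adj i k) (f (x k) (e i k))%:E)%E = (f (x k) (e i k))%:E}.
  by apply: (eq_bigmin j) => // *; exact: leey.
right; exists k.
have fk : f (x k) (e i k) = x i by move: ei; rewrite ek => -[].
split=> //; apply/orP; right; rewrite fk eqxx andbT; apply/andP; split => //.
apply/forallP => h; apply/implyP => ih; rewrite -lee_fin ei.
exact: (bigmin_le_cond _ (fun k => (f (x k) (e i k))%:E) ih).
Qed.

Lemma tc_le (i k : V) : tc i k -> x k <= x i.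
Proof.
case/orP => [/andP[/eqP-> _]//|/and3P[ik _ /eqP<-]].
exact/ltW/f_gt.
Qed.

Lemma tc_path_le (i : V) (p : seq V) : path tc i p ->
  forall j, j \in i :: p -> x j <= x i.
Proof.
elim: p i => [|k p IH] i /=; first by move=> _ j; rewrite inE => /eqP->.
case/andP => ik kp j; rewrite inE => /orP[/eqP->//|jk].
exact: le_trans (IH _ kp _ jk) (tc_le _ _ ik).
Qed.

(** State values never increase along a path of true constraining nodes, so [x k < x i] keeps [i]
    off the path from [k] and no node is repeated. *)
Lemma shortest_path_cons (i k : V) (p : seq V) :
  tc i k -> x k < x i -> sp k p -> sp i (k :: p).
Proof.
move=> ik lt_ki /and3P[kp up lp]; apply/and3P; split => //=.
  by rewrite ik.
apply/andP; split=> //; apply/negP => /(tc_path_le _ _ kp).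
by rewrite leNgt lt_ki.
Qed.

Lemma shortest_path_exists (i : V) : exists p, sp i p.
Proof.
(* Induction on the number of nodes with smaller state value; it drops at a true constraining
   neighbor because [f] is progressive. *)
have [n] := ubnP #|[set j | x j < x i]|; elim: n i => // n IH i.
rewrite ltnS => le_n.
have [iS|[k [ik fk tik]]] := Sinfty_or_nbr i.
  by exists [::]; rewrite /shortest_path /= iS.
have lt_ki : x k < x i by rewrite -fk f_gt.
have [|p kp] := IH k; last by exists (k :: p); exact: shortest_path_cons.
apply: leq_trans le_n; apply: proper_card; apply/properP; split.
  by apply/subsetP => j; rewrite !inE => /lt_trans; apply.
by exists k; rewrite !inE // ltxx.
Qed.

Lemma longest_gt0 (i : V) : (0 < len i)%N.
Proof. by have [p /longest_ge] := shortest_path_exists i; case: (len i). Qed.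

(** Prepending [i] to a longest shortest path from [k] gives a longer one from [i]. Hence [longest]
    can serve as the induction rank in both error estimates. *)
Lemma Sinfty_or_nbr_longest (i : V) : i \in Sinfty s x \/
  exists k, [/\ adj i k, f (x k) (e i k) = x i & (len k < len i)%N].
Proof.
have [iS|[k [ik fk tik]]] := Sinfty_or_nbr i; [by left|right].
exists k; split=> //; have [p kp <-] := longest_attained k (longest_gt0 k).
by apply: (longest_ge i (k :: p)); apply: shortest_path_cons; rewrite // -fk f_gt.
Qed.

End ShortestPaths.

(** * Geometric sums and capture by the dead zone *)

(** This recursion mirrors one edge of error propagation: the old error is multiplied by [L], and
    one new unit is added. *)
Lemma WS {R : realType} (L : R) (n : nat) : W L n.+1 = 1 + L * W L n.
Proof.
rewrite /W big_ord_recl expr0 mulr_sumr; congr (_ + _).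
by apply: eq_bigr => i _; rewrite /= /bump exprS.
Qed.

Lemma W_homo {R : realType} (L : R) : 0 <= L -> {homo W L : m n / (m <= n)%N >-> m <= n}.
Proof.
move=> L0; apply: homo_leq => [x|y x z|k]; [exact: lexx|exact: le_trans|].
by rewrite /W big_ord_recr lerDl exprn_ge0.
Qed.

(* Once u enters [lo, hi] the dead zone keeps it there; until then u grows by
   delta per step and is released at the latest when it exceeds M. *)
Lemma dead_zone_capture {R : realType} (u : nat -> R) (v : nat -> \bar R)
  (g : R -> R) (lo hi M delta D : R) (n : nat) :
  (forall m, (u m.+1)%:E =
     if (M <= u m) || (`|(u m)%:E - v m| <= D%:E)%E then v m else (g (u m))%:E) ->
  (forall m, lo <= u m) -> (forall m, (lo%:E <= v m <= hi%:E)%E) ->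
  (forall m, u m + delta <= g (u m)) ->
  hi - lo <= D -> M <= lo + n%:R * delta ->
  forall m, (n < m)%N -> u m <= hi.
Proof.
move=> urec ulo vb gu hlD Mn.
(* Both [u m] and [v m] lie in a window of width at most [D], so the dead zone test succeeds and the
   new value is [v m]. *)
have stay m : u m <= hi -> u m.+1 <= hi.
  move=> uhi; have := urec m; have := vb m; have lou := ulo m.
  case: (v m) => [w| |] /andP[]; rewrite ?lee_fin // => low whi.
  suff -> : `|u m - w| <= D by rewrite orbT => -[->].
  by rewrite ler_norml; lra.
have stays m k : (m <= k)%N -> u m <= hi -> u k <= hi.
  by move=> /subnKC <- um; elim: (k - m)%N => [|j IH]; rewrite ?addn0 // addnS stay.
(* Either the window has been reached by step [m], or all [m] steps so far added at least
   [delta]. *)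
have grow m : (exists2 j, (j <= m)%N & u j <= hi) \/ lo + m%:R * delta <= u m.
  elim: m => [|m [[j jm uj]|um]]; first by right; rewrite mul0r addr0.
    by left; exists j => //; exact: leqW.
  have := urec m; case: ifP => _ ev.
    by left; exists m.+1 => //; rewrite -lee_fin ev; have /andP[] := vb m.
  case: ev => ->; right; apply: le_trans (gu m); rewrite -natr1; lra.
move=> m nm; have [[j jn uj]|un] := grow n.
  by apply: stays uj; exact: leq_trans jn (ltnW nm).
(* After [n] growth steps [u n] has reached [M], so the next value is [v n]; this release costs the
   one extra step in [n < m]. *)
apply: (stays n.+1) => //; have := urec n; rewrite (le_trans Mn un) /= => ev.
by rewrite -lee_fin ev; have /andP[] := vb n.
Qed.

(** * Error propagation through [update], with [beta] a common lower bound on the edge values *)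

Section Spreading.
Context {R : realType} {V : finType} (adj : rel V) (s : V -> \bar R).
Context (beta eps sigma L1 L2 : R) (f : R -> R -> R).
Hypothesis sigma_gt0 : 0 < sigma.
Hypothesis L1_gt0 : 0 < L1.
Hypothesis L2_gt0 : 0 < L2.
Hypothesis f_prog : forall a b : R, 0 <= a -> beta <= b -> a + sigma < f a b.
Hypothesis f_mono1 : forall a1 a2 b : R, 0 <= a1 -> 0 <= a2 -> beta <= b ->
  a2 <= a1 -> f a2 b <= f a1 b.
Hypothesis f_mono2 : forall a b1 b2 : R, 0 <= a -> beta <= b1 -> beta <= b2 ->
  b2 <= b1 -> f a b2 <= f a b1.
Hypothesis f_lip2 : forall a b1 b2 : R, 0 <= a -> beta <= b1 -> beta <= b2 ->
  `|f a b1 - f a b2| <= L1 * `|b1 - b2|.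
Hypothesis f_lip1 : forall a1 a2 b : R, 0 <= a1 -> 0 <= a2 -> beta <= b ->
  `|f a1 b - f a2 b| <= L2 * `|a1 - a2|.
(* On a one-node graph nothing forces eps to be nonnegative. *)
Hypothesis eps_ge0 : (1 < #|V|)%N -> 0 <= eps.

(** Only upper bounds relate [z] to [y] and [b2] to [b1]. Monotonicity therefore first raises the
    arguments to [y + C] and [b1 + eps], and the Lipschitz conditions then compare with [f y b1]. *)
Lemma f_perturb (y z b1 b2 C : R) : 0 <= y -> 0 <= z -> beta <= b1 ->
  beta <= b2 -> 0 <= eps -> 0 <= C -> z <= y + C -> b2 <= b1 + eps ->
  f z b2 <= f y b1 + (L1 * eps + L2 * C).
Proof.
move=> y0 z0 hb1 hb2 eps0 C0 zy b21.
have yC0 : 0 <= y + C by exact: addr_ge0.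
have beps : beta <= b1 + eps by lra.
have f1 : f z b2 <= f (y + C) b2 by exact: f_mono1.
have f2 : f (y + C) b2 <= f (y + C) (b1 + eps) by exact: f_mono2.
have := f_lip1 (y + C) y (b1 + eps) yC0 y0 beps.
have := f_lip2 y (b1 + eps) b1 y0 beps hb1.
rewrite [y + C - y]addrC [b1 + eps - b1]addrC !addKr (ger0_norm eps0) (ger0_norm C0).
by move=> /(le_trans (ler_norm _)) h1 /(le_trans (ler_norm _)) h2; lra.
Qed.

(** The index bounds cover a negative [eps]: it can occur only on a graph with at most one node,
    where both indices are 0. *)
Lemma W_scale_le (a b : nat) : (a < #|V|)%N -> (b < #|V|)%N ->
  W L2 a <= W L2 b -> W L2 a * (L1 * eps) <= W L2 b * (L1 * eps).
Proof.
move=> aV bV Wab; have [V1|/eps_ge0 eps0] := leqP #|V| 1.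
  by move: (leq_trans aV V1) (leq_trans bV V1); case: (a) (b) => [|?] [|?].
by rewrite ler_wpM2r // mulr_ge0 // ltW.
Qed.

Lemma W_scale_homo (a b : nat) : (a <= b)%N -> (b < #|V|)%N ->
  W L2 a * (L1 * eps) <= W L2 b * (L1 * eps).
Proof.
move=> ab bV; apply: W_scale_le => //; first exact: leq_ltn_trans bV.
exact: W_homo (ltW L2_gt0) _ _ ab.
Qed.

Lemma W_scale_ge0 (a : nat) : (a < #|V|)%N -> 0 <= W L2 a * (L1 * eps).
Proof.
move=> /(W_scale_homo 0) H; apply: le_trans (H _) => //.
by rewrite /W big_ord0 mul0r.
Qed.

Section Bound.
Context (e : V -> V -> R) (x : V -> R).
Hypothesis e_ge : forall i k, adj i k -> beta <= e i k.
Hypothesis x_stat : stationary adj f e s x.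

Notation len := (longest adj f e s x).
Notation bound i := (x i + W L2 (len i).-1 * (L1 * eps)).

Lemma stationary_ge0 (i : V) : 0 <= x i. Proof. by case: (x_stat i). Qed.

Lemma stationary_prog (i k : V) : adj i k -> x k < f (x k) (e i k).
Proof.
move=> ik; apply: lt_trans (f_prog _ _ (stationary_ge0 k) (e_ge _ _ ik)).
by rewrite ltrDl.
Qed.

(** Induction step shared by the comparison of two stationary points and by the upper bound on the
    estimates. A node of [Sinfty] is capped by [s i = x i]; any other inherits the error of a true
    constraining neighbor of smaller rank. *)
Lemma update_le_bound (e2 : V -> V -> R) (z : V -> R) (i : V) :
  (forall k, adj i k -> beta <= e2 i k <= e i k + eps) ->
  (forall k, 0 <= z k) ->
  (forall k, (len k < len i)%N -> z k <= bound k) ->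
  (update adj f e2 s z i <= (bound i)%:E)%E.
Proof.
move=> e2_bnd z0 IH.
have len0 := longest_gt0 _ _ _ _ _ x_stat stationary_prog.
have lenV j : ((len j).-1 < #|V|)%N by rewrite prednK ?longest_le_card.
have [iS|[k [ik fk lt_ki]]] := Sinfty_or_nbr_longest _ _ _ _ _ x_stat stationary_prog i.
  apply: le_trans (update_le_max _ _ _ _ _ _) _.
  by move: iS; rewrite inE => /eqP <-; rewrite lee_fin lerDl W_scale_ge0.
apply: le_trans (update_le_nbr _ _ _ _ _ _ _ ik) _; rewrite lee_fin.
have /andP[lo2 hi2] := e2_bnd k ik.
(* Two distinct positive ranks force [longest] at [i] to be at least 2, hence at least two nodes. *)
have eps0 : 0 <= eps.
  apply: eps_ge0; rewrite (leq_trans _ (longest_le_card adj f e s x i)) //.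
  exact: leq_ltn_trans (len0 k) lt_ki.
apply: le_trans (f_perturb _ _ _ _ _ (stationary_ge0 k) (z0 k) (e_ge _ _ ik) lo2 eps0
  (W_scale_ge0 _ (lenV k)) (IH _ lt_ki) hi2) _.
(* The propagated error is [W] at the rank of [k], which is at most the rank of [i] minus one. *)
rewrite fk lerD2l mulrA -{1}[L1 * eps]mul1r -mulrDl -WS W_scale_homo //.
by move: lt_ki (len0 k); case: (len i) (len k) => [|a] [|b].
Qed.

End Bound.

(** The stationary point [x] of [e2] equals its own update, so it can play the role of the estimates
    in the shared induction step. *)
Lemma stationary_le_bound (e1 e2 : V -> V -> R) (x y : V -> R) :
  (forall i k, adj i k -> beta <= e1 i k) ->
  (forall i k, adj i k -> beta <= e2 i k <= e1 i k + eps) ->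
  stationary adj f e1 s y -> stationary adj f e2 s x ->
  forall i, x i <= y i + W L2 (longest adj f e1 s y i).-1 * (L1 * eps).
Proof.
move=> e1_ge e2_bnd y_stat x_stat i.
have [n] := ubnP (longest adj f e1 s y i); elim: n i => // n IH i.
rewrite ltnS => le_n; rewrite -lee_fin (proj2 (x_stat i)).
apply: update_le_bound => //; first exact: e2_bnd.
  by move=> k; case: (x_stat k).
by move=> k lt_ki; apply: IH; exact: leq_trans lt_ki le_n.
Qed.

(** * Evolution of the estimates [z n] under edge values [E n], first from below *)

Section Dynamics.
Context (M delta D : R) (g : R -> R).
Hypothesis delta_gt0 : 0 < delta.
Hypothesis g_ge : forall y : R, 0 <= y -> y + delta <= g y.
Context (E : nat -> V -> V -> R) (z : nat -> V -> R).
Hypothesis z_rec : forall n i, (z n.+1 i)%:E =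
  if (M <= z n i) || (`|(z n i)%:E - update adj f (E n) s (z n) i| <= D%:E)%E
  then update adj f (E n) s (z n) i else (g (z n i))%:E.

Section Lower.
Context (em : V -> V -> R) (X : V -> R).
Hypothesis em_ge : forall i k, adj i k -> beta <= em i k.
Hypothesis E_ge : forall n i k, adj i k -> em i k <= E n i k.
Hypothesis X_stat : stationary adj f em s X.

Lemma update_ge (n : nat) (i : V) (c : R) : 0 <= c ->
  (forall k, Num.min (X k) c <= z n k) ->
  ((Num.min (X i) (c + sigma))%:E <= update adj f (E n) s (z n) i)%E.
Proof.
move=> c0 zc; have [_ Xi] := X_stat i.
have XE : ((Num.min (X i) (c + sigma))%:E <= (X i)%:E)%E.
  by rewrite lee_fin ge_min lexx.
apply: le_update => [|k ik].
  by apply: le_trans XE _; rewrite Xi update_le_max.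
have X0 := proj1 (X_stat k); have zk := zc k.
have m0 : 0 <= Num.min (X k) c by rewrite le_min X0.
have z0 := le_trans m0 zk.
have bE : beta <= E n i k by apply: le_trans (E_ge _ _ _ ik); exact: em_ge.
have f1 := f_mono2 _ _ _ m0 bE (em_ge _ _ ik) (E_ge n _ _ ik).
have f2 := f_mono1 _ _ _ z0 m0 bE zk.
rewrite lee_fin; apply: le_trans f2; apply: le_trans f1.
(* If [X k <= c], stationarity of [X] bounds the candidate below by [X i]; otherwise progressiveness
   gives [c + sigma]. *)
case: (leP (X k) c) => _.
  by rewrite ge_min -lee_fin Xi update_le_nbr.
by rewrite ge_min (ltW (f_prog _ _ c0 (em_ge _ _ ik))) orbT.
Qed.

Lemma spread_ge (c : R) : 0 <= c -> (forall i, Num.min (X i) c <= z 0%N i) ->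
  forall n i, Num.min (X i) (c + n%:R * Num.min delta sigma) <= z n i.
Proof.
move=> c0 z0c; set mu := Num.min delta sigma.
have mu0 : 0 <= mu by rewrite le_min !ltW.
elim=> [|n IH] i; first by rewrite mul0r addr0.
have cn0 : 0 <= c + n%:R * mu by rewrite addr_ge0 // mulr_ge0.
have step : c + n.+1%:R * mu = c + n%:R * mu + mu by rewrite -natr1; lra.
have mud : mu <= delta by rewrite ge_min lexx.
have mus : mu <= sigma by rewrite ge_min lexx orbT.
(* The floor rises by [sigma] when the candidate is adopted and by [delta] when [g] is applied; the
   smaller gain holds in both cases. *)
rewrite step -lee_fin z_rec; case: ifP => _.
  apply: le_trans (update_ge n i _ cn0 IH); rewrite lee_fin.
  by rewrite le_min !ge_min lexx /= lerD2l mus orbT.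
have X0 := proj1 (X_stat i).
have m0 : 0 <= Num.min (X i) (c + n%:R * mu) by rewrite le_min X0.
rewrite lee_fin; apply: le_trans (g_ge _ (le_trans m0 (IH i))).
have := IH i.
case: (leP (X i) (c + n%:R * mu)) => ? ?;
  rewrite ge_min; apply/orP; [left|right]; lra.
Qed.

Lemma spread_ge_eventually (c : R) (N : nat) : 0 <= c ->
  (forall i, Num.min (X i) c <= z 0%N i) ->
  (maxS [set: V] X - c) / Num.min delta sigma <= N%:R ->
  forall n i, (N <= n)%N -> X i <= z n i.
Proof.
move=> c0 z0c; rewrite ler_pdivrMr ?lt_min ?delta_gt0 // => hN n i Nn.
apply: le_trans (spread_ge c c0 z0c n i); rewrite le_min lexx /=.
have := le_maxS X i.
suff : N%:R * Num.min delta sigma <= n%:R * Num.min delta sigma by lra.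
by rewrite ler_wpM2r ?ler_nat // le_min !ltW.
Qed.

(** * Upper bound on the estimates, level by level *)

Section Upper.
Context (e : V -> V -> R) (x : V -> R) (N : nat) (T : nat -> nat).
Hypothesis e_ge : forall i k, adj i k -> beta <= e i k.
Hypothesis E_le : forall n i k, adj i k -> E n i k <= e i k + eps.
Hypothesis x_stat : stationary adj f e s x.

Notation len := (longest adj f e s x).
Notation bound i := (x i + W L2 (len i).-1 * (L1 * eps)).

Hypothesis z_ge : forall n i, (N <= n)%N -> X i <= z n i.
Hypothesis bound_gap : forall i, bound i - X i <= D.
Hypothesis T_ge : forall i, M <= X i + (T (len i).-1)%:R * delta.

Lemma spread_le_eventually (n : nat) (i : V) :
  (N + \sum_(l < len i) (T l).+1 <= n)%N -> z n i <= bound i.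
Proof.
have X0 j : 0 <= X j by case: (X_stat j).
have len0 := longest_gt0 _ _ _ _ _ x_stat (stationary_prog e x e_ge x_stat).
have [h] := ubnP (len i); elim: h n i => // h IH n i; rewrite ltnS => le_h.
have sum_homo a b : (a <= b)%N -> (\sum_(l < a) (T l).+1 <= \sum_(l < b) (T l).+1)%N.
  move=> ab; rewrite -!(big_mkord xpredT (fun l => (T l).+1)).
  by rewrite (big_cat_nat (n := a) (p := b)) //= leq_addr.
(* From [tau] on, all nodes of smaller rank obey their bounds. Time restarts there, and [T] at the
   level of [i] plus one further steps capture [i] in the window from [X i] to its bound. *)
set tau := (N + \sum_(l < (len i).-1) (T l).+1)%N => le_n.
have Ntau : (N <= tau)%N by exact: leq_addr.
have lt_n : (tau + T (len i).-1 < n)%N.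
  by apply: leq_trans le_n; rewrite -(prednK (len0 i)) big_ord_recr /= addnA addnS.
have -> : n = (tau + (n - tau))%N.
  by rewrite subnKC //; apply: leq_trans (ltnW lt_n); exact: leq_addr.
apply: (@dead_zone_capture _ (fun m => z (tau + m) i)
   (fun m => update adj f (E (tau + m)) s (z (tau + m)) i) g (X i) _ M delta D
   (T (len i).-1)) => // [m|m|m|m|].
- by rewrite addnS z_rec.
- by rewrite z_ge // (leq_trans Ntau) ?leq_addr.
- have zX k : X k <= z (tau + m)%N k by rewrite z_ge // (leq_trans Ntau) ?leq_addr.
  apply/andP; split.
    (* With the floor at the maximum of [X] the truncation is void, so [update_ge] gives [X i]
       itself as lower bound. *)
    have XM k := le_maxS X k.
    have XMs k : Num.min (X k) (maxS [set: V] X + sigma) = X k.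
      by apply/min_idPl; apply: le_trans (XM k) _; rewrite lerDl ltW.
    rewrite -XMs; apply: update_ge => [|k]; first exact: le_trans (XM i).
    by rewrite ge_min zX.
  apply: update_le_bound => // [k ik|k|k lt_ki].
  + by rewrite E_le // andbT; apply: le_trans (em_ge _ _ ik) (E_ge _ _ _ ik).
  + exact: le_trans (zX k).
  + apply: IH; first exact: leq_trans lt_ki le_h.
    apply: leq_trans (leq_addr m tau); rewrite leq_add2l sum_homo //.
    by rewrite -ltnS prednK.
- by apply: g_ge; apply: le_trans (X0 i) _; rewrite z_ge // (leq_trans Ntau) ?leq_addr.
- by rewrite ltn_subRL.
Qed.

End Upper.

End Lower.

End Dynamics.

End Spreading.

(** * Durations and the final error bound *)

(** The edge found here carries a perturbation of absolute value at most [eps], which forces [eps]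
    to be nonnegative. *)
Lemma connected_adj {V : finType} {adj : rel V} :
  (forall i j : V, connect adj i j) -> (1 < #|V|)%N -> exists i k, adj i k.
Proof.
move=> conn /card_gt1P[i [j [_ _ neq_ij]]].
have /connectP[[|k p] /= path_ip e_j] := conn i j; first by rewrite e_j eqxx in neq_ij.
by exists i, k; case/andP: path_ip.
Qed.

Theorem theorem3 (R : realType) (V : finType) (adj : rel V)
  (adj_sym : symmetric adj) (adj_irr : irreflexive adj)
  (adj_conn : forall i j : V, connect adj i j)
  (e : V -> V -> R) (emin eps : R)
  (emin_gt0 : 0 < emin)
  (e_sym : forall i k, adj i k -> e i k = e k i)
  (e_ge : forall i k, adj i k -> emin <= e i k)
  (s : V -> \bar R)
  (s_ge0 : forall i, (0 <= s i)%E)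
  (Sstar_neq0 : Sstar s != set0)
  (eps_lt : eps < emin)
  (f : R -> R -> R) (sigma L1 L2 : R)
  (sigma_gt0 : 0 < sigma) (L1_gt0 : 0 < L1) (L2_gt0 : 0 < L2)
  (f_prog : forall a b : R, 0 <= a -> emin - eps <= b -> a + sigma < f a b)
  (f_mono1 : forall a1 a2 b : R, 0 <= a1 -> 0 <= a2 -> emin - eps <= b ->
     a2 <= a1 -> f a2 b <= f a1 b)
  (f_mono2 : forall a b1 b2 : R, 0 <= a -> emin - eps <= b1 -> emin - eps <= b2 ->
     b2 <= b1 -> f a b2 <= f a b1)
  (f_lip2 : forall a b1 b2 : R, 0 <= a -> emin - eps <= b1 -> emin - eps <= b2 ->
     `|f a b1 - f a b2| <= L1 * `|b1 - b2|)
  (f_lip1 : forall a1 a2 b : R, 0 <= a1 -> 0 <= a2 -> emin - eps <= b ->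
     `|f a1 b - f a2 b| <= L2 * `|a1 - a2|)
  (M delta D : R) (M_ge0 : 0 <= M) (delta_gt0 : 0 < delta) (D_ge0 : 0 <= D)
  (g : R -> R) (g_ge : forall y : R, 0 <= y -> y + delta <= g y)
  (t0 : int) (pert : int -> V -> V -> R)
  (pert_le : forall (t : int) (i k : V), t0 <= t -> adj i k -> `|pert t i k| <= eps)
  (xhat : int -> V -> R)
  (xhat0_ge0 : forall i, 0 <= xhat t0 i)
  (xhat_rec : forall (t : int) (i : V), t0 <= t ->
     let xtilde := update adj f (fun j k => e j k + pert t j k) s (xhat t) i in
     (xhat (t + 1) i)%:E =
       if (M <= xhat t i) || (`|(xhat t i)%:E - xtilde| <= D%:E)%E
       then xtilde else (g (xhat t i))%:E)
  (x X : V -> R)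
  (x_stat : stationary adj f e s x)
  (X_stat : stationary adj f (fun i k => e i k - eps) s X) :
  let DG := eff_diam adj f e s x in
  let DGm := eff_diam adj f (fun i k => e i k - eps) s X in
  (W L2 DGm.-1 + W L2 DG.-1) * L1 * eps <= D ->
  forall (i : V) (t : int),
    t0 + Tminus s X (xhat t0) delta sigma
      + \sum_(l < DG) Tlminus (Fset adj f e s x l) X M delta <= t ->
    `|xhat t i - x i| <= eps * L1 * Num.max (W L2 DG.-1) (W L2 DGm.-1).
Proof.
move=> DG DGm leD i t le_t.
have eps_ge0 : (1 < #|V|)%N -> 0 <= eps.
  move=> /(connected_adj adj_conn) [j [k jk]].
  exact: le_trans (normr_ge0 _) (pert_le t0 j k (lexx t0) jk).
pose em j k := e j k - eps; rewrite -/em in X_stat.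
set E := fun (n : nat) j k => e j k + pert (t0 + n%:Z) j k.
set z := fun n : nat => xhat (t0 + n%:Z).
have t0n (n : nat) : t0 <= t0 + n%:Z by rewrite lerDl.
have pertb (n : nat) j k : adj j k -> - eps <= pert (t0 + n%:Z) j k <= eps.
  by move=> /(pert_le _ _ _ (t0n n)); rewrite ler_norml.
have eps_adj j k : adj j k -> 0 <= eps.
  by move=> jk; have := pertb 0%N j k jk; lra.
have em_ge j k : adj j k -> emin - eps <= em j k.
  by move=> /e_ge; rewrite /em; lra.
have e_ge' j k : adj j k -> emin - eps <= e j k.
  by move=> jk; move: (e_ge _ _ jk) (eps_adj _ _ jk); lra.
have E_ge n j k : adj j k -> em j k <= E n j k.
  by move=> /(pertb n); rewrite /em /E; lra.
have E_le n j k : adj j k -> E n j k <= e j k + eps.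
  by move=> /(pertb n); rewrite /E; lra.
have z_rec n j : (z n.+1 j)%:E =
    if (M <= z n j) || (`|(z n j)%:E - update adj f (E n) s (z n) j| <= D%:E)%E
    then update adj f (E n) s (z n) j else (g (z n j))%:E.
  by rewrite {1}/z -addn1 PoszD addrA; exact: xhat_rec.
have X0 j : 0 <= X j by case: (X_stat j).
set c := L1 * eps.
(* The nominal edge values are the shrunken ones raised by exactly [eps]. *)
have x_le_X j : x j <= X j + W L2 (longest adj f em s X j).-1 * c.
  apply: (stationary_le_bound adj s (emin - eps) eps sigma L1 L2 f) => // a b ab.
  by rewrite e_ge' //= /em; lra.
have DG_card : (DG.-1 < #|V|)%N by exact: eff_diam_le_card.
have DGm_card : (DGm.-1 < #|V|)%N by exact: eff_diam_le_card.
have W_scale := W_scale_le eps L1 L2 L1_gt0 eps_ge0.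
have W_homo := W_scale_homo eps L1 L2 L1_gt0 L2_gt0 eps_ge0.
have x_le j : x j <= X j + W L2 DGm.-1 * c.
  by apply: le_trans (x_le_X j) _; rewrite lerD2l W_homo ?longest_le_eff_diam.
have W_len_le j : W L2 (longest adj f e s x j).-1 * c <= W L2 DG.-1 * c.
  by rewrite W_homo ?longest_le_eff_diam.
(* The hypothesis on [D] enters here: the window splits at [x j] into parts bounded by the [DGm] and
   [DG] terms. *)
have gap j : x j + W L2 (longest adj f e s x j).-1 * c - X j <= D.
  by move: leD (x_le j) (W_len_le j); rewrite -mulrA -/c mulrDl; lra.
have [N Nt z_ge] : exists2 N : nat, Tminus s X (xhat t0) delta sigma = N%:Z &
    forall n j, (N <= n)%N -> X j <= z n j.
  have z0 : z 0%N = xhat t0 by rewrite /z addr0.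
  (* Nodes outside [Uset] start at [s j], which is at least [X j], so only [Uset] determines the
     initial floor. *)
  have X_le_s j : j \notin Uset s (xhat t0) -> X j <= xhat t0 j.
    rewrite !inE negbK => /andP[_ /eqP ej].
    by rewrite -lee_fin ej (proj2 (X_stat j)) update_le_max.
  have eventually := spread_ge_eventually adj s (emin - eps) sigma f sigma_gt0
    f_prog f_mono1 f_mono2 M delta D g delta_gt0 g_ge E z z_rec em X em_ge E_ge X_stat.
  rewrite /Tminus; case: ifPn => [/eqP U0|/set0Pn[u uU]].
    (* With [Uset] empty every estimate starts above [X], so the floor can be the maximum of [X] at
       once. *)
    exists 0%N => //; apply: (eventually (maxS [set: V] X)).
    - by apply: le_trans (X0 i) _; exact: le_maxS.
    - by move=> j; rewrite z0 ge_min X_le_s // U0 inE.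
    - by rewrite subrr mul0r.
  set q := Num.ceil _.
  exists (absz (Num.max 0 q)); first by rewrite gez0_abs // le_max lexx.
  apply: (eventually (minS (Uset s (xhat t0)) (xhat t0))).
  - by have [j _ ->] := minS_attained _ (xhat t0) _ uU.
  - move=> j; rewrite z0 ge_min; have [jU|jU] := boolP (j \in Uset s (xhat t0)).
      by rewrite minS_le ?orbT.
    by rewrite X_le_s.
  - rewrite natr_absz ger0_norm ?le_max ?lexx // -ceil_le_int.
    by rewrite le_max lexx orbT.
pose T l := absz (Num.max 0 (Num.ceil ((M - minS (Fset adj f e s x l) X) / delta))).
have TE l : Tlminus (Fset adj f e s x l) X M delta = ((T l).+2)%:Z.
  by rewrite -[(T l).+2]addn2 PoszD gez0_abs // le_max lexx.
have len0 : forall j, (0 < longest adj f e s x j)%N.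
  apply: longest_gt0 => //.
  exact: (stationary_prog adj s (emin - eps) sigma f sigma_gt0 f_prog e x e_ge' x_stat).
have T_ge j : M <= X j + (T (longest adj f e s x j).-1)%:R * delta.
  (* Membership of [j] in its own level gives [minS] of that level at most [X j]. *)
  have jF : j \in Fset adj f e s x (longest adj f e s x j).-1 by rewrite inE prednK.
  have : (M - minS (Fset adj f e s x (longest adj f e s x j).-1) X) / delta
      <= (T (longest adj f e s x j).-1)%:R.
    rewrite natr_absz ger0_norm ?le_max ?lexx // -ceil_le_int.
    by rewrite le_max lexx orbT.
  by rewrite ler_pdivrMr //; have := minS_le _ X _ jF; lra.
have [n [tn le_n]] : exists n : nat, t = t0 + n%:Z /\
    (N + \sum_(l < DG) (T l).+2 <= n)%N.
  move: le_t; rewrite Nt (eq_bigr (fun l : 'I_DG => ((T l).+2)%:Z) (fun l _ => TE l)).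
  rewrite -(big_morph _ PoszD (erefl _)).
  rewrite -addrA -PoszD => le_t.
  exists (absz (t - t0)); have tt0 : 0 <= t - t0.
    by rewrite subr_ge0; apply: le_trans le_t; rewrite lerDl.
  by rewrite -lez_nat gez0_abs // [t0 + (t - t0)]addrC subrK lerBrDl.
have z_le : z n i <= x i + W L2 (longest adj f e s x i).-1 * c.
  apply: (spread_le_eventually adj s (emin - eps) eps sigma L1 L2 f _ _ _ _ _ _ _ _ eps_ge0
    M delta D g _ E z z_rec em X em_ge E_ge X_stat e x N T) => //.
  apply: leq_trans le_n; rewrite leq_add2l.
  have lenD : (longest adj f e s x i <= DG)%N.
    exact: (leq_bigmax (F := fun i => longest adj f e s x i)).
  rewrite -(big_mkord xpredT (fun l => (T l).+1)) -(big_mkord xpredT (fun l => (T l).+2)).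
  rewrite [leqRHS](big_cat_nat (n := longest adj f e s x i)) //=.
  (* Levels beyond the rank of [i] only lengthen the wait; the others compare termwise. *)
  by apply: leq_trans (leq_addr _ _); apply: leq_sum.
have z_geX : X i <= z n i.
  by apply: z_ge; apply: leq_trans le_n; exact: leq_addr.
have c_max a b : (a < #|V|)%N -> (b < #|V|)%N ->
    W L2 a * c <= c * Num.max (W L2 a) (W L2 b).
  by move=> aV bV; rewrite [leRHS]mulrC; case: (leP (W L2 a)) => // Wab; exact: W_scale.
rewrite tn -/(z n) ler_norml [eps * L1]mulrC -/c.
(* From below, [X i <= z n i] and [X i] is within the [DGm] term of [x i]; from above, [z_le] gives
   the [DG] term. *)
have := c_max _ _ DG_card DGm_card; have := c_max _ _ DGm_card DG_card.
rewrite maxC; move: (x_le i) (W_len_le i); lra.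
Qed.
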